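(* There is a function $g:\mathbb{Z}_{\ge 1}\to\mathbb{R}_{\ge 0}$ with $g(t)/t\to 0$ as $t\to\infty$ such that for all positive integers $t,n$ with $t\le n<4t/3$, every graph on $n$ vertices with no $K_t$-minor has at most $$2^{\,4t-3n+2(n-t)\log_2 3+g(t)}$$ cliques.
   Context: All graphs are finite and simple. A clique of a graph is a set of pairwise adjacent vertices; the empty set and single vertices count as cliques (so the complete graph on $n$ vertices has $2^n$ cliques). A graph $H$ is a minor of a graph $G$ if $H$ can be obtained (up to isomorphism) from $G$ by contracting edges and deleting vertices and edges. The function $g$ makes explicit the error term $o(t)$. *)

(* Defs.v *)
From mathcomp Require Import all_boot.

Set Implicit Arguments.
Unset Strict Implicit.
Unset Printing Implicit Defensive.

Record sgraph := SGraph {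
  vertex :> finType;
  adj : rel vertex;
  adj_sym : symmetric adj;
  adj_irrefl : irreflexive adj }.

Section Operations.
Variable G : sgraph.

Definition del_vertex_rel (v : G) : rel {x : G | x != v} :=
  fun x y => adj (val x) (val y).

Lemma del_vertex_sym v : symmetric (@del_vertex_rel v).
Proof. by move=> x y; apply: adj_sym. Qed.

Lemma del_vertex_irrefl v : irreflexive (@del_vertex_rel v).
Proof. by move=> x; apply: adj_irrefl. Qed.

Definition del_vertex (v : G) : sgraph :=
  SGraph (@del_vertex_sym v) (@del_vertex_irrefl v).

Definition del_edge_rel (u v : G) : rel G :=
  fun x y => adj x y && ([set x; y] != [set u; v]).

Lemma del_edge_sym u v : symmetric (del_edge_rel u v).
Proof. by move=> x y; rewrite /del_edge_rel adj_sym setUC. Qed.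

Lemma del_edge_irrefl u v : irreflexive (del_edge_rel u v).
Proof. by move=> x; rewrite /del_edge_rel adj_irrefl. Qed.

Definition del_edge (u v : G) : sgraph :=
  SGraph (@del_edge_sym u v) (@del_edge_irrefl u v).

(* The vertex v is merged into u, so u stands for the contracted edge; loops
   and parallel edges are discarded. *)
Definition contract_edge_rel (u v : G) : rel {x : G | x != v} :=
  fun x y => (x != y) &&
    [|| adj (val x) (val y),
        (val x == u) && adj v (val y) |
        (val y == u) && adj (val x) v].

Lemma contract_edge_sym u v : symmetric (@contract_edge_rel u v).
Proof.
move=> x y; rewrite /contract_edge_rel eq_sym (adj_sym (val x) (val y)).
by rewrite (adj_sym v (val y)) (adj_sym (val x) v) [X in _ || X]orbC.
Qed.

Lemma contract_edge_irrefl u v : irreflexive (@contract_edge_rel u v).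
Proof. by move=> x; rewrite /contract_edge_rel eqxx. Qed.

Definition contract_edge (u v : G) : sgraph :=
  SGraph (@contract_edge_sym u v) (@contract_edge_irrefl u v).

Definition clique (S : {set G}) : bool :=
  [forall x in S, forall y in S, (x != y) ==> adj x y].

Definition num_cliques : nat := #|[set S : {set G} | clique S]|.

End Operations.

Definition sgraph_iso (G H : sgraph) : Prop :=
  exists2 f : G -> H, bijective f & {mono f : x y / adj x y}.

(* [minor H G]: H is a minor of G. *)
Inductive minor (H : sgraph) : sgraph -> Prop :=
| minor_iso (G : sgraph) : sgraph_iso G H -> minor H G
| minor_del_vertex (G : sgraph) (v : G) : minor H (del_vertex v) -> minor H G
| minor_del_edge (G : sgraph) (u v : G) :
    adj u v -> minor H (del_edge u v) -> minor H G
| minor_contract_edge (G : sgraph) (u v : G) :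
    adj u v -> minor H (contract_edge u v) -> minor H G.

Definition complete_rel (n : nat) : rel 'I_n := fun x y => x != y.

Lemma complete_sym n : symmetric (@complete_rel n).
Proof. by move=> x y; rewrite /complete_rel eq_sym. Qed.

Lemma complete_irrefl n : irreflexive (@complete_rel n).
Proof. by move=> x; rewrite /complete_rel eqxx. Qed.

Definition complete_graph (n : nat) : sgraph :=
  SGraph (@complete_sym n) (@complete_irrefl n).

(* Main.v *)
Require Import Defs.
From mathcomp Require Import all_boot all_order all_algebra.
From mathcomp Require Import zify ring lra.
Import Order.TTheory GRing.Theory Num.Theory.

(** The error term is a constant: a graph on n vertices with no K_t minor has
    at most (9/8)^n (4/3)^(2t + 324) cliques, and
    (9/8)^n (4/3)^(2t) = 2^(4t - 3n + 2(n - t) log_2 3).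

    For a vertex v let N(v) be the set of vertices not adjacent to v, called
    the nonneighbours of v; v is one of them.  A clique of a vertex set S either
    avoids v, or is v together with a clique of S \ N(v)
    (num_cliques_in_branch).  If |S inter N(v)| is large for
    some v, the second kind is so rare that this recursion already gives the
    growth rate 9/8 per vertex: 8/9 + (8/9)^19 <= 1, so more than 18
    nonneighbours are enough.

    Otherwise every vertex of S has at most 18 nonneighbours in S.  Let K be a
    maximum clique of S.  Each vertex conflicts with at most 18^2 = 324
    vertices of S, where two vertices conflict when they have a common
    nonneighbour in S.  So a greedy matching of nonconflicting vertices of S \ K misses at
    most 324 of them.  Any two vertices that do not conflict are adjacent, and
    every vertex of S is adjacent to one of them.  Hence contracting the edges
    of the matching gives, together with K, a complete minor of order at least
    (|S| + |K| - 324) / 2 (complete_minor_of_sparse_complement), and excluding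
    a K_t minor forces |K| <= 2t + 324 - |S|.

    It remains to bound the number of cliques of S in terms of |S| and the
    clique number k (num_cliques_in_le_clique_size).  By Zykov's theorem the
    maximum is attained by complete multipartite graphs with k balanced parts,
    and has the value prod (1 + s_i), where s_1, ..., s_k are the sizes of the
    parts.  As 1 + s <= (4/3) (3/2)^s with equality for s = 1 and s = 2, this
    is at most (3/2)^|S| (4/3)^k, with equality when all parts have size 1 or
    2.  This last bound has a direct proof by the same branching.  For
    k = 2t + 324 - |S| it becomes (9/8)^|S| (4/3)^(2t + 324). *)

Set Implicit Arguments.
Unset Strict Implicit.
Unset Printing Implicit Defensive.

(** * Complete minors from branch sets *)

(** The inductive form of a minor model: each label names a branch set, and
    unlabelled vertices get deleted.  Branch sets are cliques rather than merely
    connected sets because this property survives a contraction at once, and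
    the branch sets needed here have one or two vertices. *)
Lemma complete_minor_of_labels (t : nat) (G : sgraph) (f : G -> option 'I_t) :
    (forall i, exists x, f x = Some i) ->
    (forall x y, x != y -> f x = f y -> f x -> adj x y) ->
    (forall i j, i != j ->
       exists x y, [/\ f x = Some i, f y = Some j & adj x y]) ->
  minor (complete_graph t) G.
Proof.
have [n] := ubnP #|G|; elim: n G f => // n IHn G f ltGn f_surj f_clique f_adj.
have card_sub (v : G) : #|{: {x : G | x != v}}| < n.
  have : 0 < #|G| by apply/card_gt0P; exists v.
  by have := cardC1 v; rewrite -card_sig; lia.
have [v /eqP fv | f_total] := pickP (fun v => f v == None).
  apply: (minor_del_vertex (v := v)).
  have neq_v x i : f x = Some i -> x != v.
    by move=> fx; apply: contra_eq_neq fv => <-; rewrite fx.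
  apply: (IHn (del_vertex v) (f \o val)) => /=.
  - exact: card_sub.
  - by move=> i; have [x fx] := f_surj i; exists (Sub x (neq_v x i fx)).
  - by move=> x y neq_xy; apply: f_clique.
  - move=> i j /f_adj[x [y [fx fy xy]]].
    by exists (Sub x (neq_v x i fx)), (Sub y (neq_v y j fy)).
have /fin_all_exists[h fE] x : exists i, f x = Some i.
  by move: (f_total x); case: (f x) => // i _; exists i.
have [[u v] /= /andP[neq_uv /eqP fuv] | f_inj] :=
    pickP (fun p : G * G => (p.1 != p.2) && (f p.1 == f p.2)).
  have adj_uv : adj u v by apply: f_clique => //; rewrite fE.
  apply: (minor_contract_edge adj_uv).
  (* The retraction of G onto the contracted graph. *)
  pose r x : contract_edge u v := insubd (Sub u neq_uv) x.
  have rE x : val (r x) = if x == v then u else x.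
    by rewrite val_insubd; case: eqP.
  have f_r x : f (val (r x)) = f x by rewrite rE; case: eqP => // ->.
  have adj_r x y : f x != f y -> adj x y -> adj (r x) (r y).
    move=> neq_f xy; rewrite /= /contract_edge_rel !rE.
    have -> /= : r x != r y.
      by apply: contra_neq neq_f => eq_r; rewrite -f_r eq_r f_r.
    have [eq_xv | _] := eqVneq x v; have [eq_yv | _] := eqVneq y v.
    - by rewrite eq_xv eq_yv adj_irrefl in xy.
    - by rewrite eqxx -eq_xv xy orbT.
    - by rewrite eqxx -eq_yv xy !orbT.
    - by rewrite xy.
  apply: (IHn (contract_edge u v) (f \o val)) => /=.
  - exact: card_sub.
  - by move=> i; have [x fx] := f_surj i; exists (r x); rewrite f_r.
  - move=> x y neq_xy fxy fx_some.
    by rewrite /contract_edge_rel neq_xy f_clique.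
  - move=> i j neq_ij; have [x [y [fx fy xy]]] := f_adj i j neq_ij.
    exists (r x), (r y); rewrite !f_r; split=> //; apply: adj_r => //.
    by rewrite fx fy (inj_eq Some_inj).
(* Every vertex has a label and no label is shared: G is complete. *)
apply: minor_iso.
have h_inj : injective h.
  move=> x y eq_h; apply/eqP/negPn/negP => neq_xy.
  by have := f_inj (x, y); rewrite /= neq_xy !fE eq_h eqxx.
exists h.
  apply: inj_card_bij => //; rewrite -(card_codom h_inj).
  apply: subset_leq_card; apply/subsetP => i _.
  by have [x] := f_surj i; rewrite fE => -[<-]; exact: codom_f.
move=> x y; rewrite /= /complete_rel (inj_eq h_inj).
have [-> | neq_xy] := eqVneq x y; first by rewrite adj_irrefl.
have [|x' [y' []]] := f_adj (h x) (h y); first by rewrite (inj_eq h_inj).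
by rewrite !fE => -[/h_inj ->] [/h_inj ->] ->.
Qed.

Lemma complete_minor_of_branch_sets (t : nat) (G : sgraph) (P : {set {set G}}) :
    trivIset P -> set0 \notin P -> {in P, forall Q : {set G}, clique Q} ->
    {in P &, forall Q Q' : {set G}, Q != Q' ->
       exists x y, [/\ x \in Q, y \in Q' & adj x y]} ->
    t <= #|P| ->
  minor (complete_graph t) G.
Proof.
move=> trivP P0 P_clique P_adj le_tP.
pose B (i : 'I_t) : {set G} := enum_val (widen_ord le_tP i).
have BP i : B i \in P by apply: enum_valP.
have B_inj : injective B.
  by move=> i j /enum_val_inj /(congr1 val) /= /val_inj.
pose f x : option 'I_t := [pick i | x \in B i].
have fP x i : reflect (f x = Some i) (x \in B i).
  rewrite /f; case: pickP => [j xBj | /(_ i) ->]; last by constructor.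
  have [eq_ij | neq_ij] := eqVneq i j; first by rewrite eq_ij xBj; constructor.
  have /trivIsetP/(_ _ _ (BP i) (BP j)) := trivP.
  rewrite (inj_eq B_inj) neq_ij => /(_ isT) /disjointFl -/(_ _ xBj) ->.
  by constructor=> -[eq_ji]; rewrite eq_ji eqxx in neq_ij.
apply: (complete_minor_of_labels (f := f)).
- move=> i; have /set0Pn[x xB] : B i != set0 by apply: contraNneq P0 => <-.
  by exists x; apply/fP.
- move=> x y neq_xy eq_fxy; case fx: (f x) => [i|] // _.
  move: (P_clique _ (BP i)) => /forall_inP/(_ x) Bx.
  have /forall_inP/(_ y) := Bx (introT (fP x i) fx).
  by move/(_ (introT (fP y i) (etrans (esym eq_fxy) fx)))/implyP/(_ neq_xy).
- move=> i j neq_ij.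
  have [|x [y [xB yB xy]]] := P_adj _ _ (BP i) (BP j).
    by rewrite (inj_eq B_inj).
  by exists x, y; split=> //; apply/fP.
Qed.

(** * Branching over a vertex *)

Section Cliques.
Variable G : sgraph.
Implicit Types (S K : {set G}) (u v w : G).

Lemma cliqueP K : reflect {in K &, forall x y, x != y -> adj x y} (clique K).
Proof.
apply: (iffP forall_inP) => [Kc x y /Kc/forall_inP Kx /Kx/implyP // | Kc x xK].
by apply/forall_inP => y yK; apply/implyP; apply: Kc.
Qed.

Lemma sub_clique K K' : K' \subset K -> clique K -> clique K'.
Proof.
move=> /subsetP sK /cliqueP Kc.
by apply/cliqueP => x y /sK xK /sK; apply: Kc.
Qed.

(** The closed neighbourhood of v in the complement of G. *)
Definition nonadj v : {set G} := [set w | ~~ adj v w].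

Lemma nonadj_sym u v : (u \in nonadj v) = (v \in nonadj u).
Proof. by rewrite !inE adj_sym. Qed.

Lemma nonadj_self v : v \in nonadj v.
Proof. by rewrite inE adj_irrefl. Qed.

Lemma clique_setU1 v K :
  clique K -> [disjoint K & nonadj v] -> clique (v |: K).
Proof.
move=> /cliqueP Kc Kv; have adjv x : x \in K -> adj v x.
  by move=> /(disjointFr Kv); rewrite inE => /negbFE.
apply/cliqueP => x y /setU1P[->|xK] /setU1P[->|yK] neq_xy.
- by rewrite eqxx in neq_xy.
- exact: adjv.
- by rewrite adj_sym; apply: adjv.
- exact: Kc.
Qed.

Definition num_cliques_in S := #|[set K : {set G} | clique K & K \subset S]|.

(** The cliques of S that contain v are determined by their other members,
    which are all adjacent to v. *)
Lemma num_cliques_in_branch S v :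
  num_cliques_in S <= num_cliques_in (S :\ v) + num_cliques_in (S :\: nonadj v).
Proof.
rewrite /num_cliques_in; set A := [set K | _ & _].
rewrite -(cardsID [set K : {set G} | v \in K] A) addnC leq_add //.
  apply/subset_leq_card/subsetP => K.
  rewrite !inE => /andP[vK /andP[-> KS]].
  rewrite /= subsetD1 KS; exact: vK.
have inj_rem : {in A :&: [set K : {set G} | v \in K] &,
    injective (fun K : {set G} => K :\ v)}.
  move=> K K'; rewrite !inE => /andP[_ vK] /andP[_ vK'] eqK.
  by rewrite -(setD1K vK) eqK setD1K.
rewrite -(card_in_imset inj_rem).
apply/subset_leq_card/subsetP => _ /imsetP[K + ->].
rewrite !inE => /andP[/andP[Kc KS] vK].
rewrite (sub_clique (subsetDl _ _) Kc) /=; apply/subsetP => x.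
rewrite !inE => /andP[neq_xv xK]; rewrite (subsetP KS) // andbT negbK.
by move/cliqueP: Kc; apply=> //; rewrite eq_sym.
Qed.

(** * Complete minors in graphs with a sparse complement *)

(** Greedily: a vertex that remains among more than d vertices has a partner
    with which it does not conflict. *)
Lemma greedy_pairing (c : rel G) d S : {in S, forall u, c u u} ->
    {in S, forall u, #|[set w in S | c u w]| <= d} ->
  exists P : {set {set G}},
    [/\ trivIset P, cover P \subset S, #|S| <= d + 2 * #|P| &
        {in P, forall Q, exists u v, Q = [set u; v] /\ ~~ c u v}].
Proof.
have [n] := ubnP #|S|; elim: n S => // n IHn S ltSn c_refl le_d.
have [leSd | ltdS] := leqP #|S| d.
  exists set0; rewrite cards0 addn0 /cover big_set0 sub0set.
  by split=> // [|Q]; rewrite ?inE //; apply/trivIsetP => Q Q'; rewrite inE.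
have [u uS] : exists u, u \in S by apply/set0Pn; rewrite -card_gt0; lia.
have [v vS ncuv] : exists2 v, v \in S & ~~ c u v.
  have /subsetPn[v vS] : ~~ (S \subset [set w in S | c u w]).
    by apply: contraL ltdS => /subset_leq_card; have := le_d u uS; lia.
  by rewrite inE vS => ncuv; exists v.
have neq_uv : u != v by apply: contraNneq ncuv => <-; apply: c_refl.
have cardS : #|S| = #|S :\: [set u; v]| + 2.
  have := cardsID [set u; v] S.
  by rewrite (setIidPr _) ?cards2 ?neq_uv 1?addnC // subUset !sub1set uS.
have [|||P [trivP coverP leP pairP]] := IHn (S :\: [set u; v]).
- by lia.
- by move=> w /setDP[/c_refl].
- move=> w /setDP[wS _]; apply: leq_trans (le_d w wS).
  by apply/subset_leq_card/subsetP => x; rewrite !inE => /andP[/andP[_ ->] ->].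
have disj Q : Q \in P -> [disjoint [set u; v] & Q].
  move=> QP; have /subsetP sQ := subset_trans (bigcup_sup Q QP) coverP.
  rewrite disjoint_sym; apply/pred0P => x /=; apply/negbTE/negP => /andP[/sQ].
  by rewrite inE => /andP[/negP].
have uvNP : [set u; v] \notin P.
  apply/negP => /disj; rewrite -setI_eq0 setIid => /eqP/setP/(_ u).
  by rewrite !inE eqxx.
exists ([set u; v] |: P); split.
- apply/trivIsetP => Q Q' /setU1P[->|QP] /setU1P[->|Q'P] neqQ.
  + by rewrite eqxx in neqQ.
  + exact: disj.
  + by rewrite disjoint_sym; apply: disj.
  + exact: (trivIsetP trivP).
- rewrite /cover big_setU1 //= subUset subUset !sub1set uS vS /=.
  exact: subset_trans coverP (subsetDl _ _).
- by rewrite cardsU1 uvNP; lia.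
- by move=> Q /setU1P[->|/pairP //]; exists u, v.
Qed.

(** The branch sets are the single vertices of K and the pairs of a greedy
    matching of S \ K.  A nonconflicting pair has no common nonneighbour in S,
    so it dominates S, and in particular every other branch set; as each vertex
    belongs to its own N(v), it is moreover an edge.  The conflicts of a vertex
    number at most d * d, being nonneighbours of nonneighbours. *)
Lemma complete_minor_of_sparse_complement t d S K :
    {in S, forall v, #|S :&: nonadj v| <= d} -> clique K -> K \subset S ->
    2 * t + d * d <= #|S| + #|K| + 1 ->
  minor (complete_graph t) G.
Proof.
move=> le_d K_clique KS le_t.
pose c u v := ~~ [disjoint S :&: nonadj u & nonadj v].
have c_refl u : u \in S -> c u u.
  by move=> uS; apply/pred0Pn; exists u; rewrite /= in_setI uS nonadj_self.
have card_c : {in S :\: K, forall u, #|[set w in S :\: K | c u w]| <= d * d}.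
  move=> u /setDP[uS _].
  apply: (@leq_trans #|\bigcup_(x in S :&: nonadj u) (S :&: nonadj x)|).
    apply/subset_leq_card/subsetP => w /setIdP[/setDP[wS _]].
    case/pred0Pn => x /andP[/= xu xw]; apply/bigcupP; exists x => //.
    by rewrite in_setI wS nonadj_sym.
  apply: (@leq_trans (\sum_(x in S :&: nonadj u) d)).
    elim/big_ind2: _ => [|a A b B leA leB|x /setIP[/le_d //]].
      by rewrite cards0.
    by apply: leq_trans (leq_card_setU A B) (leq_add leA leB).
  by rewrite sum_nat_const leq_mul2r le_d ?orbT.
have [|P [trivP coverP leP pairP]] := greedy_pairing _ card_c.
  by move=> u /setDP[/c_refl].
have in_P Q x : Q \in P -> x \in Q -> x \in S :\: K.
  by move=> QP xQ; apply: (subsetP coverP); apply/bigcupP; exists Q.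
have P_dom Q w : Q \in P -> w \in S -> exists2 x, x \in Q & adj x w.
  move=> QP wS; have [u [v [eqQ /negPn disj]]] := pairP Q QP.
  have [uw | nuw] := boolP (adj u w).
    by exists u; rewrite // eqQ !inE eqxx.
  exists v; first by rewrite eqQ !inE eqxx orbT.
  have := disjointFr disj (_ : w \in _).
  by rewrite !inE wS nuw => /(_ isT)/negbFE.
have P_clique Q : Q \in P -> clique Q.
  move=> QP; have [u [v [eqQ _]]] := pairP Q QP.
  have adj_uv : u != v -> adj u v.
    have uQ : u \in Q by rewrite eqQ !inE eqxx.
    have [|x xQ xu] := P_dom Q u QP; first by have /setDP[] := in_P Q u QP uQ.
    by move: xQ xu; rewrite eqQ => /set2P[] ->; rewrite ?adj_irrefl // adj_sym.
  apply/cliqueP => x y.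
  rewrite eqQ => /set2P[] -> /set2P[] ->; rewrite ?eqxx //.
  by rewrite eq_sym adj_sym.
pose singles := [set [set x] | x in K].
have disj_PK Q x : Q \in P -> x \in K -> x \notin Q.
  by move=> QP; apply: contraL => /(in_P Q x QP)/setDP[].
have set0P : set0 \notin P.
  apply/negP => /pairP[u [v [/setP/(_ u)]]].
  by rewrite !inE eqxx.
apply: (@complete_minor_of_branch_sets t G (P :|: singles)).
- apply/trivIsetP => Q Q' /setUP[QP | /imsetP[x xK ->]];
    move=> /setUP[Q'P | /imsetP[y yK ->]] neqQ.
  + exact: (trivIsetP trivP).
  + by rewrite disjoint_sym disjoints1 disj_PK.
  + by rewrite disjoints1 disj_PK.
  + by rewrite disjoints1 inE; apply: contra_neqN neqQ => /eqP ->.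
- rewrite in_setU negb_or set0P /=; apply/imsetP => -[x _ /setP/(_ x)].
  by rewrite !inE eqxx.
- move=> Q /setUP[/P_clique // | /imsetP[x _ ->]].
  by apply/cliqueP => y z /set1P-> /set1P->; rewrite eqxx.
- have PS Q : Q \in P :|: singles -> exists2 w, w \in Q & w \in S.
    case/setUP => [QP | /imsetP[x xK ->]].
      have [u [v [eqQ _]]] := pairP Q QP.
      have uQ : u \in Q by rewrite eqQ !inE eqxx.
      by exists u => //; have /setDP[] := in_P Q u QP uQ.
    by exists x; rewrite ?set11 // (subsetP KS).
  move=> Q Q' QF Q'F; have [w' w'Q' w'S] := PS _ Q'F.
  have [/(P_dom Q w')/(_ w'S)[x xQ xw'] _ | QnP] := boolP (Q \in P).
    by exists x, w'.
  have [w wQ wS] := PS _ QF.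
  have [/(P_dom Q' w)/(_ wS)[x xQ' xw] _ | Q'nP] := boolP (Q' \in P).
    by exists w, x; rewrite adj_sym.
  move: QF Q'F; rewrite !in_setU (negPf QnP) (negPf Q'nP) /=.
  move=> /imsetP[x xK ->] /imsetP[y yK ->] neq_xy; exists x, y.
  rewrite !set11; split=> //.
  by move/cliqueP: K_clique; apply=> //; apply: contra_neq neq_xy => ->.
- have disjP : [disjoint P & singles].
    apply/pred0P => Q /=; apply/negbTE/negP => /andP[QP /imsetP[x xK eqQ]].
    by have := disj_PK Q x QP xK; rewrite eqQ set11.
  have := cardsID K S; rewrite (setIidPr KS).
  have := leq_card_setU P singles; rewrite disjP => /leqifP/eqP ->.
  rewrite card_imset; last exact: set1_inj.
  by lia.
Qed.

(** * Cliques in terms of the clique number *)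

Local Open Scope ring_scope.

(** Branch over any v in S.  Extending by v shows that S \ N(v) has smaller
    clique number.  If N(v) meets S in v only, both branches are S \ v, and
    2 = (3/2) (4/3).  Otherwise S \ N(v) has lost at least two vertices, and
    the bound is reproduced because 2/3 + (2/3)^2 (3/4) = 1. *)
Lemma num_cliques_in_le_clique_size (R : realFieldType) S k :
    (forall K, clique K -> K \subset S -> (#|K| <= k)%N) ->
  (num_cliques_in S)%:R <= (3 / 2 : R) ^+ #|S| * (4 / 3) ^+ k.
Proof.
have [n] := ubnP #|S|; elim: n S k => // n IHn S k ltSn le_k.
have [-> | [v vS]] := set_0Vmem S.
  have -> : num_cliques_in set0 = 1%N.
    rewrite -(cards1 (set0 : {set G})); apply: eq_card => K.
    rewrite !inE subset0 andbC; case: eqP => //= ->.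
    by apply/cliqueP => x y; rewrite inE.
  by rewrite cards0 mul1r exprn_ege1 //; lra.
have le_branch K : clique K -> K \subset S :\: nonadj v -> (#|K| < k)%N.
  move=> Kc; rewrite subsetD => /andP[KS Kv].
  have vK : v \notin K.
    apply: contraL Kv => vK; apply/pred0Pn.
    by exists v; rewrite /= vK nonadj_self.
  have := le_k (v |: K); rewrite cardsU1 vK; apply; first exact: clique_setU1.
  by rewrite subUset sub1set vS.
have k_gt0 : (0 < k)%N.
  apply: (leq_ltn_trans (leq0n _)) (le_branch set0 _ (sub0set _)).
  by apply/cliqueP => x y; rewrite inE.
have cardSv : (#|S| = #|S :\ v|.+1)%N by rewrite (cardsD1 v) vS.
have le_branch' K : clique K -> K \subset S :\: nonadj v -> (#|K| <= k.-1)%N.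
  by move=> Kc /(le_branch _ Kc); lia.
have bound_N := IHn _ _ _ le_branch'.
have := num_cliques_in_branch S v.
rewrite -(ler_nat R) natrD => /le_trans; apply.
have sub_S : S :\: nonadj v \subset S :\ v.
  by apply: setDS; rewrite sub1set nonadj_self.
have := sub_S; rewrite subEproper => /orP[/eqP eqS | /proper_card lt_card].
  rewrite eqS in bound_N *.
  have := bound_N _; rewrite cardSv -{2}(prednK k_gt0) !exprS => bound.
  have {}bound := bound ltac:(lia).
  set X := _ ^+ _ in bound *; set Y := _ ^+ _ in bound *; lra.
have bound_v : (num_cliques_in (S :\ v))%:R <=
    (3 / 2 : R) ^+ #|S :\ v| * (4 / 3) ^+ k.
  apply: IHn => [|K Kc KS]; first by lia.
  by apply: le_k => //; apply: subset_trans KS (subsetDl _ _).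
have [s eq_s] : exists s, #|S :\ v| = s.+1 by exists #|S :\ v|.-1; lia.
have {}bound_N : (num_cliques_in (S :\: nonadj v))%:R <=
    (3 / 2 : R) ^+ s * (4 / 3) ^+ k.-1.
  apply: le_trans (bound_N _) _; first by lia.
  by rewrite ler_pM2r ?exprn_gt0 ?ler_weXn2l //; [lra | lia | lra].
move: bound_v bound_N; rewrite cardSv eq_s -{1 3}(prednK k_gt0) !exprS.
set X := _ ^+ s; set Y := _ ^+ _; lra.
Qed.

(** * The clique bound in graphs without a complete minor *)

(** The factor (4/3)^(2t + 324) is inert in the branching over vertices with
    more than 18 nonneighbours; it comes from the sets S without such vertices,
    where |K| <= 2t + 324 - |S| for a maximum clique K. *)
Lemma num_cliques_in_le_no_minor (R : realFieldType) t S :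
    ~ minor (complete_graph t) G ->
  (num_cliques_in S)%:R <= (9 / 8 : R) ^+ #|S| * (4 / 3) ^+ (2 * t + 324).
Proof.
move=> no_minor; have [n] := ubnP #|S|; elim: n S => // n IHn S ltSn.
have [/exists_inP[v vS gt18] | ] :=
    boolP [exists v in S, 18 < #|S :&: nonadj v|]%N.
  have cardSv : (#|S| = #|S :\ v|.+1)%N by rewrite (cardsD1 v) vS.
  have := cardsID (nonadj v) S => cardSN.
  have := num_cliques_in_branch S v.
  rewrite -(ler_nat R) natrD => /le_trans; apply.
  have bound_v := IHn (S :\ v) ltac:(lia).
  have bound_N := IHn (S :\: nonadj v) ltac:(lia).
  set C := (4 / 3) ^+ _ in bound_v bound_N *.
  have C_gt0 : 0 < C by rewrite exprn_gt0 //; lra.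
  set m := #|S :\: nonadj v| in bound_N cardSN *.
  have le_m : (m + 18 <= #|S :\ v|)%N by lia.
  (* The threshold 18: as (9/8)^18 >= 8, the two branches together weigh at
     most 8/9 + (8/9) / 8 = 1. *)
  have pow18 : 8 <= (9 / 8 : R) ^+ 18.
    have pow6 : 2 <= (9 / 8 : R) ^+ 6 by rewrite !exprS expr0; lra.
    rewrite (_ : 18 = 6 * 3)%N // exprM.
    have -> : 8 = 2 ^+ 3 :> R by ring.
    by rewrite lerXn2r // ?nnegrE ?exprn_ge0 //; lra.
  have : 8 * (9 / 8 : R) ^+ m <= (9 / 8) ^+ #|S :\ v|.
    apply: le_trans (_ : (9 / 8) ^+ (m + 18) <= _); last first.
      by rewrite ler_weXn2l //; lra.
    by rewrite exprD mulrC ler_wpM2l // exprn_ge0 //; lra.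
  rewrite cardSv exprS; move: bound_v bound_N.
  set X := _ ^+ #|_|; set Y := _ ^+ m => bv bN leXY.
  have : 8 * (Y * C) <= X * C by rewrite mulrA ler_pM2r.
  lra.
rewrite negb_exists_in => /forall_inP le18.
have set0_clique : clique (set0 : {set G}) && (set0 \subset S).
  by rewrite sub0set andbT; apply/cliqueP => x y; rewrite inE.
pose clique_in K := clique K && (K \subset S).
have [K /andP[K_clique KS] K_max] :=
  @arg_maxnP _ set0 clique_in (fun K => #|K|) set0_clique.
have le_K : (#|S| + #|K| <= 2 * t + 324)%N.
  rewrite leqNgt; apply/negP => gt_K; apply: no_minor.
  apply: (@complete_minor_of_sparse_complement t 18 S K) => //; last by lia.
  by move=> v /le18; rewrite -leqNgt.
apply: le_trans (num_cliques_in_le_clique_size (k := #|K|) _ _) _.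
  by move=> K' K'_clique K'S; apply: K_max; apply/andP.
have -> : (3 / 2 : R) = (9 / 8) * (4 / 3) by field.
rewrite exprMn -mulrA -exprD ler_wpM2l ?exprn_ge0 ?ler_weXn2l //; lra.
Qed.

Lemma num_cliques_le_no_minor (R : realFieldType) t :
    ~ minor (complete_graph t) G ->
  (num_cliques G)%:R <= (9 / 8 : R) ^+ #|G| * (4 / 3) ^+ (2 * t + 324).
Proof.
move=> no_minor.
have := num_cliques_in_le_no_minor R setT no_minor; rewrite cardsT.
rewrite /num_cliques_in /num_cliques.
rewrite (eq_card (B := [set K : {set G} | clique K])) //.
by move=> K; rewrite !inE subsetT andbT.
Qed.
End Cliques.

(** * Powers of two and the error term *)

From mathcomp Require Import all_classical all_reals all_analysis.
Import numFieldNormedType.Exports.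

Local Open Scope classical_set_scope.
Local Open Scope ring_scope.

(** With L = log_2 3, 9/8 = 2^(2L - 3) and 4/3 = 2^(2 - L). *)
Lemma clique_bound_powR (R : realType) (n k : nat) :
  (9 / 8 : R) ^+ n * (4 / 3) ^+ k =
    2 `^ ((2 * (ln 3 / ln 2) - 3) * n%:R + (2 - ln 3 / ln 2) * k%:R).
Proof.
have ln2_neq0 : ln 2 != 0 :> R by rewrite gt_eqF // ln_gt0 //; lra.
have pow_ln3 : 2 `^ (ln 3 / ln 2) = 3 :> R.
  by rewrite /powR ifF ?divfK ?lnK ?posrE //; apply/eqP; lra.
have two_neq0 : 2 != 0 :> R by rewrite pnatr_eq0.
have powB x y : 2 `^ (x - y) = 2 `^ x / 2 `^ y :> R.
  by rewrite powRD ?two_neq0 ?implybT // powRN.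
have -> : (9 / 8 : R) = 2 `^ (2 * (ln 3 / ln 2) - 3).
  by rewrite powB (mulrC 2) powRrM pow_ln3 !powR_mulrn //; field.
have -> : (4 / 3 : R) = 2 `^ (2 - ln 3 / ln 2).
  by rewrite powB pow_ln3 powR_mulrn //; field.
move: (2 * _ - 3) (2 - _) => a b.
by rewrite powRD ?two_neq0 ?implybT // !powRrM !powR_mulrn ?powR_ge0.
Qed.

Theorem theorem3p6 (R : realType) :
  exists g : nat -> R,
    [/\ forall t : nat, (0 < t)%N -> 0 <= g t,
        g t / t%:R @[t --> \oo] --> (0 : R) &
        forall t n : nat, (0 < t)%N -> (0 < n)%N ->
          (t <= n)%N -> n%:R < 4 * t%:R / 3 :> R ->
          forall G : sgraph, #|G| = n -> ~ minor (complete_graph t) G ->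
            (num_cliques G)%:R <=
              2 `^ (4 * t%:R - 3 * n%:R
                    + 2 * (n%:R - t%:R) * (ln 3 / ln 2) + g t) :> R].
Proof.
(* The constant log_2 ((4/3)^324). *)
exists (fun _ => 324 * (2 - ln 3 / ln 2)); split.
- move=> t _; rewrite mulr_ge0 // subr_ge0 ler_pdivrMr ?ln_gt0 //; last by lra.
  have -> : 2 * ln 2 = ln 4 :> R.
    by rewrite -[4](_ : 2 * 2 = _) ?lnM ?posrE //; ring.
  by rewrite ler_ln ?posrE //; lra.
- rewrite -(mulr0 (324 * (2 - ln 3 / ln 2))).
  apply: cvgMr; apply/gtr0_cvgV0; last exact: cvgr_idn.
  by apply: filterS (nbhs_infty_gt 0) => n; rewrite ltr0n.
- move=> t n _ _ _ _ G cardG no_minor.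
  have := num_cliques_le_no_minor R no_minor; rewrite cardG clique_bound_powR.
  move=> /le_trans; apply; rewrite ler_powR ?ler1n //.
  by rewrite natrD natrM; lra.
Qed.
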